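(* Let $(Q,g)$ be a Riemannian manifold, $V:Q\times\mathbb{R}\to\mathbb{R}$ smooth, $H:T^*Q\times\mathbb{R}\to\mathbb{R}$ the Hamiltonian of mechanical type $H(\alpha_q,z)=\tfrac12\alpha_q(\sharp_g(\alpha_q))-V(q,z)$, and $\mathcal{M}\subseteq T^*Q$ a vector subbundle. Put $\mathcal{D}=\sharp_g(\mathcal{M})\subseteq TQ$, so that $T^*Q=\mathcal{M}\oplus\mathcal{D}^{\circ}$, and let $\gamma:T^*Q\times\mathbb{R}\to\mathcal{M}\times\mathbb{R}$ be the associated projection (identity on $\mathbb{R}$). Then the contact Eden bracket $\{\cdot,\cdot\}_E$ and the nonholonomic bracket $\{\cdot,\cdot\}_{H,\mathcal{M}}$ coincide, namely, for all $f,h\in C^\infty(\mathcal{M}\times\mathbb{R})$, $$\{f,h\}_{H,\mathcal{M}}=\{f,h\}_E=\{f\circ\gamma,h\circ\gamma\}|_{\mathcal{M}\times\mathbb{R}}.$$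
   Context: $T^*Q\times\mathbb{R}$ carries canonical coordinates $(q^i,p_i,z)$, the canonical contact form $\eta_Q=\mathrm{d}z-p_i\,\mathrm{d}q^i$ and Reeb vector field $\mathcal{R}_Q=\partial/\partial z$. $\flat_Q(v)=\iota_v\mathrm{d}\eta_Q+\eta_Q(v)\eta_Q$ is a vector bundle isomorphism with inverse $\sharp_Q$. The Jacobi bivector is $\Lambda_Q(\alpha,\beta)=-\mathrm{d}\eta_Q(\sharp_Q\alpha,\sharp_Q\beta)$ and the Jacobi bracket on $C^\infty(T^*Q\times\mathbb{R})$ is $\{u,v\}=\Lambda_Q(\mathrm{d}u,\mathrm{d}v)-u\,\mathcal{R}_Q(v)+v\,\mathcal{R}_Q(u)$. $\flat_g:TQ\to T^*Q$ is the musical isomorphism of $g$, with inverse $\sharp_g$. Superscript $\circ$ is the annihilator. $\mathfrak{D}^l$ is the distribution on $T^*Q\times\mathbb{R}$ with $(\mathfrak{D}^l)^{\circ}=(\pi_{Q,\mathbb{R}})^*\mathcal{D}^{\circ}$, where $\pi_{Q,\mathbb{R}}(\alpha_q,z)=q$, and ${}^{\bot}\mathfrak{D}^l=\sharp_Q((\mathfrak{D}^l)^{\circ})$. One has $T_{\mathcal{M}\times\mathbb{R}}(T^*Q\times\mathbb{R})={}^{\bot}\mathfrak{D}^l\oplus T(\mathcal{M}\times\mathbb{R})$; $\mathcal{P}$ is the projection onto $T(\mathcal{M}\times\mathbb{R})$ and $\mathcal{P}^*(\alpha)=\alpha\circ\mathcal{P}$. Nonholonomic bracket: with $\mathcal{R}_{H,\mathcal{M}}=\mathcal{P}(\mathcal{R}_Q|_{\mathcal{M}\times\mathbb{R}})$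 and $\Lambda_{H,\mathcal{M}}(\alpha,\beta)=\Lambda_Q(\mathcal{P}^*\alpha,\mathcal{P}^*\beta)$ (which depends only on the restrictions of $\alpha,\beta$ to $T(\mathcal{M}\times\mathbb{R})$, hence is a bivector field on $\mathcal{M}\times\mathbb{R}$), $\{f,h\}_{H,\mathcal{M}}=\Lambda_{H,\mathcal{M}}(\mathrm{d}f,\mathrm{d}h)-f\,\mathcal{R}_{H,\mathcal{M}}(h)+h\,\mathcal{R}_{H,\mathcal{M}}(f)$ for $f,h\in C^\infty(\mathcal{M}\times\mathbb{R})$. Contact Eden bracket: $\{f,h\}_E=\{f\circ\gamma,h\circ\gamma\}|_{\mathcal{M}\times\mathbb{R}}$. *)

(* Defs.v *)
From HB Require Import structures.
From mathcomp Require Import all_boot all_order all_algebra.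
From mathcomp Require Import all_classical all_reals all_analysis.
Set Implicit Arguments.
Unset Strict Implicit.
Unset Printing Implicit Defensive.
Import Order.TTheory GRing.Theory Num.Theory.
Import numFieldNormedType.Exports.
Local Open Scope classical_set_scope.
Local Open Scope ring_scope.

Section Smoothness.
Context {R : realType}.

(* Meaningful for open U; on finite-dimensional spaces this is the usual
   notion of class C^k. *)
Fixpoint Ck_on {E F : normedModType R} (k : nat) (U : set E) (f : E -> F) :
    Prop :=
  if k is k'.+1 then
    (forall x, U x -> differentiable f x) /\
    (forall v : E, Ck_on k' U (fun x => 'D_v f x))
  else forall x, U x -> {for x, continuous f}.

Definition smooth_on {E F : normedModType R} (U : set E) (f : E -> F) :=
  forall k, Ck_on k U f.

(* Exterior derivative of a 1-form on a normed space, from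
   d omega (V, W) = V (omega W) - W (omega V) - omega [V, W]
   applied to constant vector fields v and w. *)
Definition ext_d {E : normedModType R} (omega : E -> E -> R) (y v w : E) : R :=
  'D_v (fun y' => omega y' w : R^o) y - 'D_w (fun y' => omega y' v : R^o) y.

Definition pairing {n : nat} (a v : 'rV[R]_n) : R := (a *m v^T) 0 0.

End Smoothness.

Section Manifolds.
Context (R : realType) (n : nat) (Q : topologicalType).

Record chart := Chart {
  dom : set Q ;
  coord : Q -> 'rV[R]_n ;
  point : 'rV[R]_n -> Q ;
  open_dom : open dom ;
  open_cod : open (coord @` dom) ;
  coordK : forall q, dom q -> point (coord q) = q ;
  coord_continuous : forall q, dom q -> {for q, continuous coord} ;
  point_continuous : forall y, (coord @` dom) y -> {for y, continuous point} }.

Definition transition (phi psi : chart) : 'rV[R]_n -> 'rV[R]_n :=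
  coord psi \o point phi.

(* chart_at selects, at each point, the chart used to represent tangent and
   cotangent vectors; it is an arbitrary part of the data. *)
Record manifold := Manifold {
  atlas : set chart ;
  chart_at : Q -> chart ;
  atlas_chart_at : forall q, atlas (chart_at q) ;
  dom_chart_at : forall q, dom (chart_at q) q ;
  smooth_transition : forall phi psi, atlas phi -> atlas psi ->
    smooth_on (coord phi @` (dom phi `&` dom psi)) (transition phi psi) ;
  manifold_hausdorff : hausdorff_space Q ;
  manifold_second_countable : @second_countable Q }.

(* A tangent vector (q, v) is given by its components v in the chart chart_at q;
   a cotangent vector (q, a) by its components a in the dual basis. The product
   topology of these types is not the bundle topology and is never used. *)
Definition tangent_bundle := (Q * 'rV[R]_n)%type.
Definition cotangent_bundle := (Q * 'rV[R]_n)%type.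

Context (X : manifold).

Definition tan_coord (phi : chart) (q : Q) (v : 'rV[R]_n) : 'rV[R]_n :=
  'd (transition (chart_at X q) phi) (coord (chart_at X q) q) v.

Definition tan_of_coord (phi : chart) (q : Q) (w : 'rV[R]_n) : 'rV[R]_n :=
  'd (transition phi (chart_at X q)) (coord phi q) w.

(* p_i = a (d / d q^i) for the coordinate frame of phi. *)
Definition cot_coord (phi : chart) (q : Q) (a : 'rV[R]_n) : 'rV[R]_n :=
  \row_i pairing a (tan_of_coord phi q (delta_mx 0 i)).

Definition cot_of_coord (phi : chart) (q : Q) (p : 'rV[R]_n) : 'rV[R]_n :=
  \row_i pairing p (tan_coord phi q (delta_mx 0 i)).

(* gram q is the Gram matrix of the inner product of T_q Q in the coordinate
   basis of chart_at q. *)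
Record riemannian_metric := RiemannianMetric {
  gram : Q -> 'M[R]_n ;
  gram_sym : forall q, (gram q)^T = gram q ;
  gram_pos : forall q (v : 'rV[R]_n), v != 0 -> 0 < pairing (v *m gram q) v ;
  gram_smooth : forall phi, atlas X phi -> forall i j : 'I_n,
    smooth_on (coord phi @` dom phi) (fun y => let q := point phi y in
      pairing (tan_of_coord phi q (delta_mx 0 i) *m gram q)
              (tan_of_coord phi q (delta_mx 0 j)) : R^o) }.

Definition flat_g (g : riemannian_metric) (v : tangent_bundle) :
  cotangent_bundle := (v.1, v.2 *m gram g v.1).

Definition sharp_g (g : riemannian_metric) (a : cotangent_bundle) :
  tangent_bundle := (a.1, a.2 *m invmx (gram g a.1)).

Definition annihilator (D : set tangent_bundle) : set cotangent_bundle :=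
  [set a | forall v : 'rV[R]_n, D (a.1, v) -> pairing a.2 v = 0].

(* The rows of theta q are a basis of the fibre of M over each q in U and are
   smooth as local sections of the cotangent bundle. *)
Record local_frame (M : set cotangent_bundle) (U : set Q) (k : nat)
    (theta : Q -> 'M[R]_(k, n)) : Prop := LocalFrame {
  frame_open : open U ;
  frame_free : forall q, U q -> row_free (theta q) ;
  frame_span : forall q, U q -> forall a, M (q, a) <-> (a <= theta q)%MS ;
  frame_smooth : forall phi, atlas X phi -> forall i : 'I_k,
    smooth_on (coord phi @` (dom phi `&` U))
      (fun y => cot_coord phi (point phi y) (row i (theta (point phi y)))) }.

Definition vector_subbundle (M : set cotangent_bundle) : Prop :=
  forall q, exists U k (theta : Q -> 'M[R]_(k, n)),
    U q /\ local_frame M U theta.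

Definition smooth_on_QxR (V : Q * R -> R) : Prop :=
  forall phi, atlas X phi ->
    smooth_on [set y : 'rV[R]_n * R^o | (coord phi @` dom phi) y.1]
      (fun y => V (point phi y.1, y.2) : R^o).

Definition mechanical (g : riemannian_metric) (V : Q * R -> R)
    (H : cotangent_bundle * R -> R) : Prop :=
  forall (a : cotangent_bundle) (z : R),
    H (a, z) = 2^-1 * pairing a.2 (sharp_g g a).2 - V (a.1, z).

(* Model space of the canonical coordinates (q^i, p_i, z), i.e.
   (y.1.1, y.1.2, y.2). *)
Local Notation E := ('rV[R]_n * 'rV[R]_n * R^o)%type.
Local Notation TQR := (cotangent_bundle * R)%type.

Definition can_coord (phi : chart) (x : TQR) : E :=
  (coord phi x.1.1, cot_coord phi x.1.1 x.1.2, x.2).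

Definition can_point (phi : chart) (y : E) : TQR :=
  (point phi y.1.1, cot_of_coord phi (point phi y.1.1) y.1.2, y.2).

(* Below, tangent vectors to T^*Q x R at a point over dom phi are represented by
   their components (an element of E) in the canonical coordinates of phi, and
   covectors by functions E -> R. *)

(* d z - p_i d q^i *)
Definition eta_Q (y v : E) : R := v.2 - pairing y.1.2 v.1.1.

Definition reeb_Q : E := (0, 0, 1).

Definition flat_Q (y v : E) : E -> R :=
  fun w => ext_d eta_Q y v w + eta_Q y v * eta_Q y w.

Definition sharp_Q (y : E) (alpha : E -> R) : E :=
  xget 0 [set v | flat_Q y v = alpha].

Definition Lambda_Q (y : E) (alpha beta : E -> R) : R :=
  - ext_d eta_Q y (sharp_Q y alpha) (sharp_Q y beta).

Definition diff_TQR (phi : chart) (u : TQR -> R) (x : TQR) : E -> R :=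
  'd (u \o can_point phi : E -> R^o) (can_coord phi x).

Definition jacobi_bracket (phi : chart) (u v : TQR -> R) (x : TQR) : R :=
  Lambda_Q (can_coord phi x) (diff_TQR phi u x) (diff_TQR phi v x)
  - u x * diff_TQR phi v x reeb_Q + v x * diff_TQR phi u x reeb_Q.

Context (M : set cotangent_bundle).

Definition MxR : set TQR := [set x | M x.1].

(* Inverse of the chart of the manifold M x R given by phi and a local frame. *)
Definition bundle_point (phi : chart) (k : nat) (theta : Q -> 'M[R]_(k, n))
    (y : 'rV[R]_n * 'rV[R]_k * R^o) : TQR :=
  (point phi y.1.1, y.1.2 *m theta (point phi y.1.1), y.2).

(* Only the values of f on M x R matter. *)
Definition smooth_on_MxR (f : TQR -> R) : Prop :=
  forall phi U k (theta : Q -> 'M[R]_(k, n)),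
    atlas X phi -> local_frame M U theta ->
    smooth_on [set y | (coord phi @` (dom phi `&` U)) y.1.1]
      (f \o bundle_point phi theta : _ -> R^o).

(* v is the image of a tangent vector of M x R at x under the differential of
   the inclusion of M x R in T^*Q x R, and c is the value of df on it. *)
Definition diff_MxR_rel (phi : chart) (f : TQR -> R) (x : TQR) (v : E) (c : R) :
    Prop :=
  exists U k (theta : Q -> 'M[R]_(k, n)) (y w : 'rV[R]_n * 'rV[R]_k * R^o),
    [/\ local_frame M U theta, U x.1.1,
        y.1.1 = coord phi x.1.1 /\ bundle_point phi theta y = x,
        v = 'd (can_coord phi \o bundle_point phi theta) y w &
        c = 'd (f \o bundle_point phi theta : _ -> R^o) y w].

Definition tangent_MxR (phi : chart) (x : TQR) : set E :=
  [set v | exists U k (theta : Q -> 'M[R]_(k, n))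
      (y w : 'rV[R]_n * 'rV[R]_k * R^o),
    [/\ local_frame M U theta, U x.1.1,
        y.1.1 = coord phi x.1.1 /\ bundle_point phi theta y = x &
        v = 'd (can_coord phi \o bundle_point phi theta) y w]].

Definition diff_MxR (phi : chart) (f : TQR -> R) (x : TQR) (v : E) : R :=
  xget 0 [set c | diff_MxR_rel phi f x v c].

Context (g : riemannian_metric).

Definition dist_D : set tangent_bundle := sharp_g g @` M.

(* Projection of T^*Q x R = (M (+) D^0) x R onto M x R. *)
Definition gamma (x : TQR) : TQR :=
  (x.1.1,
   xget 0 [set m : 'rV[R]_n | M (x.1.1, m) /\
                              annihilator dist_D (x.1.1, x.1.2 - m)],
   x.2).

(* Pullbacks of elements of D^0 by the projection onto Q, whose differential
   sends w to the tangent vector with phi-components w.1.1. *)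
Definition Dl_annihilator (phi : chart) (x : TQR) : set (E -> R) :=
  [set alpha | exists2 b : 'rV[R]_n, annihilator dist_D (x.1.1, b) &
    alpha = fun w => pairing b (tan_of_coord phi x.1.1 w.1.1)].

Definition Dl_perp (phi : chart) (x : TQR) : set E :=
  sharp_Q (can_coord phi x) @` Dl_annihilator phi x.

(* Projection onto T(M x R) along Dl_perp. *)
Definition proj_P (phi : chart) (x : TQR) (v : E) : E :=
  xget 0 [set w | tangent_MxR phi x w /\ Dl_perp phi x (v - w)].

Definition reeb_HM (phi : chart) (x : TQR) : E := proj_P phi x reeb_Q.

Definition Lambda_HM (phi : chart) (x : TQR) (alpha beta : E -> R) : R :=
  Lambda_Q (can_coord phi x) (alpha \o proj_P phi x) (beta \o proj_P phi x).

Definition nonholonomic_bracket (phi : chart) (f h : TQR -> R) (x : TQR) : R :=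
  Lambda_HM phi x (diff_MxR phi f x) (diff_MxR phi h x)
  - f x * diff_MxR phi h x (reeb_HM phi x)
  + h x * diff_MxR phi f x (reeb_HM phi x).

Definition eden_bracket (phi : chart) (f h : TQR -> R) (x : TQR) : R :=
  jacobi_bracket phi (f \o gamma) (h \o gamma) x.

End Manifolds.

(* Main.v *)
Require Import Defs.
From mathcomp Require Import all_boot all_order perm all_algebra.
From mathcomp Require Import all_classical all_reals all_analysis.
Import Order.TTheory GRing.Theory Num.Theory.
Import numFieldNormedType.Exports.
Import Defs.
Local Open Scope classical_set_scope.
Local Open Scope ring_scope.
Set Implicit Arguments.
Unset Strict Implicit.
Unset Printing Implicit Defensive.

(** The projection [gamma] is a retraction of the cotangent bundle (times R) onto
    M x R. Hence its differential at a point of M x R is idempotent with range the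
    tangent space of M x R ([tangent_MxR_fixed]). Its kernel is the space of
    vertical vectors (0, b, 0) with b in the annihilator of D. On the other hand
    d eta = dq^i /\ dp_i, so the contact isomorphism sends the pullback of a
    covector b of Q to the vertical vector (0, - b, 0): this kernel is exactly
    [Dl_perp] ([Dl_perp_kernel]). The projection [proj_P] of the nonholonomic
    bracket is therefore the differential of [gamma] ([proj_PE]).

    By the chain rule, df o [proj_P] is then the differential of f o [gamma]
    ([diff_MxR_proj_P]). So the bivector terms of the two brackets have the same
    arguments, and the Reeb terms agree as well because f o [gamma] = f on M x R.

    The analytic content is that [gamma] is differentiable. In a local frame Theta of
    M and with the Gram matrix G of the metric in the coordinates of a chart,
    [gamma] multiplies the momenta by
    G^-1 Theta^T (Theta G^-1 Theta^T)^-1 Theta, whose entries are rational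
    functions of smooth functions. The tangent space of M x R and the differential
    of a function on it are given through arbitrary local frames; comparing every
    frame with [gamma] ([diff_lift_bundle]) replaces any comparison of frames with
    each other. *)

(** * Differential calculus for matrix-valued maps *)

Section Calculus.
Context {R : realType}.
Implicit Types E F G : normedModType R.

(** The defining expansion to first order only involves values near the point. *)
Lemma differentiable_near {E F} (f g : E -> F) (x : E) :
  {near x, f =1 g} -> differentiable f x -> differentiable g x.
Proof.
move=> fg /diff_locallyP[dfc dfx]; apply/diff_locallyP.
have gE : g \o shift x = cst (g x) + 'd f x +o_ 0 id.
  apply/eqaddoP => _/posnumP[e].
  have /eqaddoP /(_ e%:num) := dfx => /(_ (gt0 e)) {}dfx.
  have fg0 : \forall h \near (0 : E), f (h + x) = g (h + x).
    by move: fg; rewrite (near_shift 0) subr0.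
  apply: filterS2 fg0 dfx => h fgh.
  by rewrite /= -(nbhs_singleton fg) !fctE /= fgh.
by rewrite (diff_unique dfc gE).
Qed.

Lemma diff_near {E F} (f g : E -> F) (x : E) :
  {near x, f =1 g} -> differentiable f x -> 'd f x = 'd g x :> (E -> F).
Proof.
move=> fg df; apply/funext => v.
have dg := differentiable_near fg df.
by rewrite -!deriveE //; exact: near_eq_derive.
Qed.

(** The chain rule, for a composite known through a simpler function that agrees
    with it near the point: all the maps below have a closed form only over the
    domain of a chart. *)
Lemma diff_comp_near {E F G} (f : E -> F) (h : F -> G) (k : E -> G) (x v : E) :
  differentiable f x -> differentiable h (f x) -> {near x, h \o f =1 k} ->
  'd h (f x) ('d f x v) = 'd k x v.
Proof.
move=> df dh hfk; rewrite -(diff_near hfk); last exact: differentiable_comp.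
by rewrite (diff_comp df dh).
Qed.

(** Along a line on which the map is affine, all difference quotients are equal. *)
Lemma derive_affine {E F} (f : E -> F) (a v : E) (l : F) :
  (\forall h \near (0 : R), f (h *: v + a) = f a + h *: l) -> 'D_v f a = l.
Proof.
move=> fl; apply: cvg_lim; first exact: norm_hausdorff.
apply: cvg_near_cst.
have h0 : \forall h \near (0 : R)^', h != 0 by exact: nbhs_dnbhs_neq.
have {}fl : \forall h \near (0 : R)^', f (h *: v + a) = f a + h *: l.
  exact: cvg_within fl.
apply: filterS2 h0 fl => h h0 fh.
by rewrite /= fh addrAC subrr add0r scalerA mulVf // scale1r.
Qed.

Lemma continuous_fst {E F} : continuous (@fst E F).
Proof. by move=> x; exact: cvg_fst. Qed.

Lemma continuous_snd {E F} : continuous (@snd E F).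
Proof. by move=> x; exact: cvg_snd. Qed.

Lemma differentiable_fst {E F} (x : E * F) : differentiable (@fst E F) x.
Proof. by apply: linear_differentiable; exact: continuous_fst. Qed.

Lemma differentiable_snd {E F} (x : E * F) : differentiable (@snd E F) x.
Proof. by apply: linear_differentiable; exact: continuous_snd. Qed.

Lemma diff_fst {E F} (x v : E * F) : 'd (@fst E F) x v = v.1.
Proof. by rewrite diff_lin //; exact: continuous_fst. Qed.

Lemma diff_snd {E F} (x v : E * F) : 'd (@snd E F) x v = v.2.
Proof. by rewrite diff_lin //; exact: continuous_snd. Qed.

Lemma differentiable_prod_ord {E} n (f : 'I_n -> E -> R) (x : E) :
  (forall i, differentiable (f i) x) ->
  differentiable (fun y => \prod_(i < n) f i y) x.
Proof.
move=> df; have -> : (fun y => \prod_(i < n) f i y) = \prod_(i < n) f i.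
  by apply/funext => y; elim/big_ind2 : _ => // ? ? ? ? -> ->.
by elim/big_ind : _ => // a b da db; exact: differentiableM.
Qed.

Lemma differentiable_mx_entry {E} m n (A : E -> 'M[R]_(m, n)) (x : E) i j :
  differentiable A x -> differentiable (fun y => A y i j : R^o) x.
Proof.
move=> dA; exact: (differentiable_comp dA (differentiable_coord _ i j)).
Qed.

Lemma differentiable_mx {E} m n (A : E -> 'M[R]_(m, n)) (x : E) :
  (forall i j, differentiable (fun y => A y i j : R^o) x) ->
  differentiable A x.
Proof.
move=> dA.
have -> : A = \sum_(i < m) \sum_(j < n) (fun y => A y i j *: delta_mx i j).
  apply/funext => y; rewrite fct_sumE [LHS]matrix_sum_delta.
  by apply: eq_bigr => i _; rewrite fct_sumE.
by do 2!apply: differentiable_sum => ?; exact: differentiableZl.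
Qed.

Lemma differentiable_mulmx {E} m n p (A : E -> 'M[R]_(m, n))
    (B : E -> 'M[R]_(n, p)) (x : E) :
  differentiable A x -> differentiable B x ->
  differentiable (fun y => A y *m B y) x.
Proof.
move=> dA dB; apply: differentiable_mx => i j.
have -> : (fun y => (A y *m B y) i j : R^o) =
    \sum_(k < n) ((fun y => A y i k) * (fun y => B y k j)).
  by apply/funext => y; rewrite fct_sumE mxE.
apply: differentiable_sum => k.
by apply: differentiableM; exact: differentiable_mx_entry.
Qed.

Lemma differentiable_trmx {E} m n (A : E -> 'M[R]_(m, n)) (x : E) :
  differentiable A x -> differentiable (fun y => (A y)^T) x.
Proof.
move=> dA; apply: differentiable_mx => i j; under eq_fun do rewrite mxE.
exact: differentiable_mx_entry.
Qed.

Lemma differentiable_det {E} n (A : E -> 'M[R]_n) (x : E) :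
  differentiable A x -> differentiable (fun y => \det (A y) : R^o) x.
Proof.
move=> dA; have -> : (fun y => \det (A y) : R^o) = \sum_(s : 'S_n)
    ((-1) ^+ s *: (fun y => \prod_(i < n) A y i (s i) : R^o)).
  by apply/funext => y; rewrite fct_sumE.
elim/big_ind : _ => [|? ? ? ?|s _]; first exact: differentiable_cst.
  exact: differentiableD.
apply: differentiableZ; apply: differentiable_prod_ord => i.
exact: differentiable_mx_entry.
Qed.

(** Cramer's rule writes the inverse as a rational function of the entries. As
    [invmx A] is [A] at a singular [A], this needs invertibility around [x]. *)
Lemma differentiable_invmx {E} n (A : E -> 'M[R]_n) (x : E) :
  differentiable A x -> (\forall y \near x, A y \in unitmx) ->
  differentiable (fun y => invmx (A y)) x.
Proof.
move=> dA uA.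
apply: (@differentiable_near _ _ (fun y => (\det (A y))^-1 *: \adj (A y))).
  by apply: filterS uA => y uAy; rewrite /invmx uAy.
apply: differentiable_mx => i j.
have -> : (fun y => ((\det (A y))^-1 *: \adj (A y)) i j : R^o) =
    (fun y => (\det (A y))^-1) * (fun y => cofactor (A y) j i).
  by apply/funext => y; rewrite !mxE.
apply: differentiableM.
  apply: differentiableV; first exact: differentiable_det.
  by have := nbhs_singleton uA; rewrite unitmxE unitfE.
rewrite /cofactor; apply: (@differentiableZ _ _ _
  (fun y => \det (row' j (col' i (A y))) : R^o)).
apply: differentiable_det; apply: differentiable_mx => k l.
by under eq_fun do rewrite !mxE; exact: differentiable_mx_entry.
Qed.

Lemma differentiable_base {E F G} (y : E * F * G) :
  differentiable (fun z : E * F * G => z.1.1) y.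
Proof.
exact: (differentiable_comp (differentiable_fst y) (differentiable_fst y.1)).
Qed.

Lemma diff_base {E F G} (y v : E * F * G) :
  'd (fun z : E * F * G => z.1.1) y v = v.1.1.
Proof.
rewrite -(diff_comp_near v (differentiable_fst y) (differentiable_fst y.1));
  last exact: filterE.
by rewrite !diff_fst.
Qed.

Lemma differentiable_over_base {E F G} {H : normedModType R} (A : E -> H)
    (y : E * F * G) :
  differentiable A y.1.1 -> differentiable (fun z : E * F * G => A z.1.1) y.
Proof.
move=> dA; apply: (@differentiable_comp _ _ _ _ (fun z => z.1.1) A) => //.
exact: differentiable_base.
Qed.

(** Coordinate form of a fibrewise linear map over the identity of the base: all
    changes of trivialization and the projection onto the subbundle have it. *)
Lemma differentiable_bundle_map {E} m p (A : E -> 'M[R]_(m, p))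
    (y : E * 'rV[R]_m * R^o) :
  differentiable A y.1.1 ->
  differentiable (fun z : E * 'rV[R]_m * R^o =>
    (z.1.1, z.1.2 *m A z.1.1, z.2) : E * 'rV[R]_p * R^o) y.
Proof.
move=> dA; apply: differentiable_pair; last exact: differentiable_snd.
apply: differentiable_pair; first exact: differentiable_base.
apply: differentiable_mulmx; last exact: differentiable_over_base.
exact: (differentiable_comp (differentiable_fst y) (differentiable_snd y.1)).
Qed.

End Calculus.

(** * Orthogonal projection onto a row space *)

Section MetricProjection.
Context {R : realType}.

(** If [S] is the Gram matrix of an inner product, [invmx S] is that of the dual
    one, for which [p *m proj_coef S T *m T] is the orthogonal projection of the
    covector [p] onto the row space of [T]; [p *m proj_coef S T] lists its
    coordinates in the rows of [T]. *)
Definition proj_coef n k (S : 'M[R]_n) (T : 'M[R]_(k, n)) : 'M[R]_(n, k) :=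
  invmx S *m T^T *m invmx (T *m invmx S *m T^T).

Lemma posdef_unitmx n (S : 'M[R]_n) :
  (forall v, v != 0 -> 0 < pairing (v *m S) v) -> S \in unitmx.
Proof.
move=> posS; rewrite -row_free_unit.
apply: inj_row_free => v vS0; apply/eqP; apply: contraTT isT => /posS.
by rewrite vS0 /pairing mul0mx mxE ltxx.
Qed.

(** If [u] is in the kernel, the vector dual to [u *m T] has length zero. *)
Lemma gram_rows_unitmx n k (S : 'M[R]_n) (T : 'M[R]_(k, n)) :
  (forall v, v != 0 -> 0 < pairing (v *m S) v) -> S^T = S -> row_free T ->
  T *m invmx S *m T^T \in unitmx.
Proof.
move=> posS symS freeT; have uS := posdef_unitmx posS.
rewrite -row_free_unit; apply: inj_row_free => u u0.
have uTS0 : u *m T *m invmx S = 0.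
  apply/eqP; apply: contraTT isT => /posS.
  rewrite /pairing mulmxKV // trmx_mul trmx_inv symS trmx_mul.
  have -> : u *m T *m (invmx S *m (T^T *m u^T)) =
      u *m (T *m invmx S *m T^T) *m u^T by rewrite !mulmxA.
  by rewrite u0 mul0mx mxE ltxx.
have uT0 : u *m T = 0 by rewrite -(mulmxKV uS (u *m T)) uTS0 mul0mx.
by apply: (row_free_injr freeT); rewrite /= uT0 mul0mx.
Qed.

Lemma mulmx_proj_coef n k (S : 'M[R]_n) (T : 'M[R]_(k, n)) :
  T *m invmx S *m T^T \in unitmx -> T *m proj_coef S T = 1%:M.
Proof. by move=> uT; rewrite /proj_coef !mulmxA mulmxV. Qed.

(** The kernel of the projection is the orthogonal complement, which is the
    annihilator of the vectors dual to the rows of [T]. *)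
Lemma mulmx_proj_coef_eq0 n k (S : 'M[R]_n) (T : 'M[R]_(k, n)) (b : 'rV[R]_n) :
  T *m invmx S *m T^T \in unitmx ->
  b *m proj_coef S T = 0 <-> b *m invmx S *m T^T = 0.
Proof.
move=> uT; rewrite /proj_coef !mulmxA; split=> [b0|->]; last exact: mul0mx.
by rewrite -[LHS](mulmxKV uT) b0 mul0mx.
Qed.

Lemma invmx_eq n (A B : 'M[R]_n) : A *m B = 1%:M -> invmx A = B.
Proof. by move=> AB; rewrite -[RHS](mulKmx (mulmx1_unit AB).1) AB mulmx1. Qed.

Lemma invmx_congr n (S J : 'M[R]_n) : S \in unitmx -> J \in unitmx ->
  invmx (J *m S *m J^T) = (invmx J)^T *m invmx S *m invmx J.
Proof.
move=> uS uJ; have uJT : J^T \in unitmx by rewrite unitmx_tr.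
by apply: invmx_eq; rewrite trmx_inv !mulmxA mulmxK // mulmxK // mulmxV.
Qed.

(** The Gram matrix of the rows of [T] does not depend on the basis: vectors
    change by [J], so covectors change by [J^T] and the metric by congruence. *)
Lemma gram_rows_change n k (S J : 'M[R]_n) (T : 'M[R]_(k, n)) :
  S \in unitmx -> J \in unitmx ->
  (T *m J^T) *m invmx (J *m S *m J^T) *m (T *m J^T)^T = T *m invmx S *m T^T.
Proof.
move=> uS uJ; have uJT : J^T \in unitmx by rewrite unitmx_tr.
by rewrite invmx_congr // trmx_mul trmxK trmx_inv !mulmxA mulmxK // mulmxKV.
Qed.

Lemma proj_coef_change n k (S J : 'M[R]_n) (T : 'M[R]_(k, n)) :
  S \in unitmx -> J \in unitmx ->
  proj_coef (J *m S *m J^T) (T *m J^T) = (invmx J)^T *m proj_coef S T.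
Proof.
move=> uS uJ; rewrite /proj_coef gram_rows_change // invmx_congr //.
by rewrite trmx_mul trmxK !mulmxA mulmxKV.
Qed.

Lemma mulmx_conj_proj_eq0 n k (J : 'M[R]_n) (C : 'M[R]_(n, k)) (T : 'M[R]_(k, n))
    (p : 'rV[R]_n) : J \in unitmx -> T *m C = 1%:M ->
  p *m (invmx J *m C *m (T *m J)) = 0 <-> p *m invmx J *m C = 0.
Proof.
move=> uJ TC; split=> [p0|pC0]; last by rewrite !mulmxA pC0 !mul0mx.
have := congr1 (mulmxr (invmx J *m C)) p0.
by rewrite /= mul0mx !mulmxA mulmxK // -(mulmxA _ T) TC mulmx1.
Qed.

End MetricProjection.

(** * The canonical contact form *)

Section ContactStructure.
Context {R : realType} {n : nat}.
Local Notation E := ('rV[R]_n * 'rV[R]_n * R^o)%type.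
Implicit Types y v w : E.

Lemma pairingDl (a b v : 'rV[R]_n) : pairing (a + b) v = pairing a v + pairing b v.
Proof. by rewrite /pairing mulmxDl mxE. Qed.

Lemma pairingZl h (a v : 'rV[R]_n) : pairing (h *: a) v = h * pairing a v.
Proof. by rewrite /pairing -scalemxAl mxE. Qed.

Lemma pairingC (a b : 'rV[R]_n) : pairing a b = pairing b a.
Proof. by rewrite /pairing -[a in LHS]trmxK -trmx_mul mxE. Qed.

Lemma pairing0l (v : 'rV[R]_n) : pairing 0 v = 0.
Proof. by rewrite /pairing mul0mx mxE. Qed.

Lemma pairing0r (v : 'rV[R]_n) : pairing v 0 = 0.
Proof. by rewrite pairingC pairing0l. Qed.

Lemma pairing_delta (a : 'rV[R]_n) i : pairing a (delta_mx 0 i) = a 0 i.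
Proof. by rewrite /pairing trmx_delta -colE mxE. Qed.

(** The 1-form eta is affine in the momenta, so d eta is the constant 2-form
    dq^i /\ dp_i. *)
Lemma ext_d_eta y v w :
  ext_d (@eta_Q R n) y v w = pairing w.1.2 v.1.1 - pairing v.1.2 w.1.1.
Proof.
have Deta a b : 'D_a (fun y' => eta_Q y' b : R^o) y = - pairing a.1.2 b.1.1.
  apply: derive_affine; apply: filterE => h.
  rewrite /eta_Q /= pairingDl pairingZl opprD addrCA addrC scalerN.
  by rewrite -[h *: _]/(h * _).
by rewrite /ext_d !Deta opprK addrC.
Qed.

Lemma flat_QE y v w : flat_Q y v w =
  pairing w.1.2 v.1.1 - pairing v.1.2 w.1.1 + eta_Q y v * eta_Q y w.
Proof. by rewrite /flat_Q ext_d_eta. Qed.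

(** Evaluating at the Reeb direction recovers the value of eta, then evaluating at
    the momentum and position directions recovers the two other components. *)
Lemma flat_Q_inj y : injective (flat_Q y).
Proof.
move=> v w vw; have {}vw u : flat_Q y v u = flat_Q y w u by rewrite vw.
have eta_vw : eta_Q y v = eta_Q y w.
  have := vw (0, 0, 1); rewrite !flat_QE /= !pairing0l !pairing0r subrr !add0r.
  by rewrite /eta_Q /= pairing0r subr0 !mulr1.
have q_vw : v.1.1 = w.1.1.
  apply/rowP => i; have := vw (0, delta_mx 0 i, 0).
  rewrite !flat_QE /= !pairing0r eta_vw => /addIr.
  by rewrite !subr0 ![pairing (delta_mx _ _) _]pairingC !pairing_delta.
have p_vw : v.1.2 = w.1.2.
  apply/rowP => i; have := vw (delta_mx 0 i, 0, 0).
  rewrite !flat_QE /= !pairing0l eta_vw => /addIr.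
  by rewrite !sub0r => /oppr_inj; rewrite !pairing_delta.
have z_vw : v.2 = w.2 by move: eta_vw; rewrite /eta_Q q_vw => /addIr.
by case: v w q_vw p_vw z_vw {vw eta_vw} => [[? ?] ?] [[? ?] ?] /= -> -> ->.
Qed.

(** [sharp_Q] is a choice among preimages, so it is computed by exhibiting one. *)
Lemma sharp_Q_flat y v : sharp_Q y (flat_Q y v) = v.
Proof. by apply: xget_subset1 => // a b /= <- /flat_Q_inj. Qed.

(** The vector (0, - b, 0) is killed by eta, hence its flat is its contraction
    with d eta. *)
Lemma sharp_Q_horizontal y (b : 'rV[R]_n) :
  sharp_Q y (fun w => pairing b w.1.1) = (0, - b, 0).
Proof.
rewrite -[RHS](sharp_Q_flat y); congr sharp_Q; apply/funext => w.
rewrite flat_QE /= /eta_Q /= !pairing0r subrr mul0r addr0 sub0r.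
by rewrite -[- b]scaleN1r pairingZl mulN1r opprK.
Qed.

End ContactStructure.

(** * Coordinates on the (co)tangent bundle *)

Section Charts.
Context {R : realType} {n : nat} {Q : topologicalType} (X : manifold R n Q).

Lemma near_chart (phi : chart R n Q) (U : set Q) q :
  open U -> dom phi q -> U q ->
  \forall y \near coord phi q,
    [/\ (coord phi @` dom phi) y, dom phi (point phi y) & U (point phi y)].
Proof.
move=> oU dq Uq.
have cq : (coord phi @` dom phi) (coord phi q) by exists q.
have pU : \forall y \near coord phi q, U (point phi y).
  apply: (point_continuous cq); rewrite coordK //; exact: open_nbhs_nbhs.
have cod : \forall y \near coord phi q, (coord phi @` dom phi) y.
  by apply: open_nbhs_nbhs; split => //; exact: open_cod.
by apply: filterS2 cod pU => y [r dr <-]; rewrite coordK //; split => //; exists r.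
Qed.

Lemma pointK (phi : chart R n Q) y :
  (coord phi @` dom phi) y -> coord phi (point phi y) = y.
Proof. by move=> [q dq <-]; rewrite coordK. Qed.

Lemma differentiable_transition (phi psi : chart R n Q) q :
  atlas X phi -> atlas X psi -> dom phi q -> dom psi q ->
  differentiable (transition phi psi) (coord phi q).
Proof.
by move=> Aphi Apsi dphi dpsi; apply: (smooth_transition Aphi Apsi 1%N).1; exists q.
Qed.

(** The two transition maps are mutually inverse on the overlap of the charts. *)
Lemma diff_transitionK (phi psi : chart R n Q) q v :
  atlas X phi -> atlas X psi -> dom phi q -> dom psi q ->
  'd (transition psi phi) (coord psi q) ('d (transition phi psi) (coord phi q) v) = v.
Proof.
move=> Aphi Apsi dphi dpsi.
have dfwd := differentiable_transition Aphi Apsi dphi dpsi.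
have := differentiable_transition Apsi Aphi dpsi dphi.
have tq : transition phi psi (coord phi q) = coord psi q.
  by rewrite /transition /= coordK.
rewrite -tq => dbwd.
rewrite (diff_comp_near (k := id) v dfwd dbwd); first by rewrite diff_val.
have := near_chart (open_dom psi) dphi dpsi.
by apply: filterS => y [cy dy1 dy2]; rewrite /transition /= coordK // pointK.
Qed.

(** Its rows are the coordinate vectors d / d q^i of [phi] at [q], expressed in the
    chart that represents the tangent vectors at [q]. As that chart is arbitrary at
    each point, [frame_mx] is not even continuous in [q]; only the combinations
    [coord_frame] and [coord_gram] below are smooth. *)
Definition frame_mx (phi : chart R n Q) q : 'M[R]_n :=
  lin1_mx ('d (transition phi (chart_at X q)) (coord phi q)).

Lemma tan_of_coordE phi q w : tan_of_coord X phi q w = w *m frame_mx phi q.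
Proof. by rewrite mul_rV_lin1. Qed.

Lemma tan_of_coordK phi q v : atlas X phi -> dom phi q ->
  tan_of_coord X phi q (tan_coord X phi q v) = v.
Proof.
move=> Aphi dphi.
exact: (diff_transitionK v (atlas_chart_at X q) Aphi (dom_chart_at X q) dphi).
Qed.

Lemma tan_coordK phi q w : atlas X phi -> dom phi q ->
  tan_coord X phi q (tan_of_coord X phi q w) = w.
Proof.
move=> Aphi dphi.
exact: (diff_transitionK w Aphi (atlas_chart_at X q) dphi (dom_chart_at X q)).
Qed.

Lemma frame_mx_unit phi q : atlas X phi -> dom phi q -> frame_mx phi q \in unitmx.
Proof.
move=> Aphi dphi; rewrite -row_free_unit; apply: inj_row_free => w w0.
by rewrite -(tan_coordK w Aphi dphi) tan_of_coordE w0 /tan_coord linear0.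
Qed.

Lemma tan_coordE phi q v : atlas X phi -> dom phi q ->
  tan_coord X phi q v = v *m invmx (frame_mx phi q).
Proof.
move=> Aphi dphi; have uJ := frame_mx_unit Aphi dphi.
by rewrite -[LHS](mulmxK uJ) -tan_of_coordE tan_of_coordK.
Qed.

Lemma pairing_row_delta (a : 'rV[R]_n) (J : 'M[R]_n) :
  \row_i pairing a (delta_mx 0 i *m J) = a *m J^T.
Proof.
apply/rowP => i; rewrite !mxE /pairing -rowE mxE; apply: eq_bigr => j _.
by rewrite !mxE.
Qed.

Lemma cot_coordE phi q a : cot_coord X phi q a = a *m (frame_mx phi q)^T.
Proof.
rewrite /cot_coord -pairing_row_delta; apply/rowP => i.
by rewrite !mxE tan_of_coordE.
Qed.

Lemma cot_of_coordE phi q p : atlas X phi -> dom phi q ->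
  cot_of_coord X phi q p = p *m (invmx (frame_mx phi q))^T.
Proof.
move=> Aphi dphi; rewrite -pairing_row_delta; apply/rowP => i.
by rewrite !mxE tan_coordE.
Qed.

Lemma can_coordK phi (x : cotangent_bundle R n Q * R) : atlas X phi ->
  dom phi x.1.1 -> can_point X phi (can_coord X phi x) = x.
Proof.
case: x => [[q a] z] Aphi dq; rewrite /can_point /can_coord /= coordK //.
rewrite cot_of_coordE // cot_coordE -mulmxA -trmx_mul mulVmx ?frame_mx_unit //.
by rewrite trmx1 mulmx1.
Qed.

Variables (g : riemannian_metric X) (M : set (cotangent_bundle R n Q)).

Definition coord_frame phi k (theta : Q -> 'M[R]_(k, n)) (y : 'rV[R]_n) :
    'M[R]_(k, n) :=
  theta (point phi y) *m (frame_mx phi (point phi y))^T.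

Definition coord_gram phi (y : 'rV[R]_n) : 'M[R]_n :=
  let J := frame_mx phi (point phi y) in J *m gram g (point phi y) *m J^T.

Lemma differentiable_coord_frame phi U k (theta : Q -> 'M[R]_(k, n)) q :
  atlas X phi -> local_frame X M U theta -> dom phi q -> U q ->
  differentiable (coord_frame phi theta) (coord phi q).
Proof.
move=> Aphi [_ _ _ smooth_theta] dq Uq; apply: differentiable_mx => i j.
have -> : (fun y => coord_frame phi theta y i j : R^o) = fun y =>
    cot_coord X phi (point phi y) (row i (theta (point phi y))) 0 j.
  by apply/funext => y; rewrite cot_coordE -row_mul [RHS]mxE.
by apply: differentiable_mx_entry; apply: (smooth_theta _ Aphi i 1%N).1; exists q.
Qed.

Lemma differentiable_coord_gram phi q : atlas X phi -> dom phi q ->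
  differentiable (coord_gram phi) (coord phi q).
Proof.
move=> Aphi dq; apply: differentiable_mx => i j.
have -> : (fun y => coord_gram phi y i j : R^o) = fun y => let r := point phi y in
    pairing (tan_of_coord X phi r (delta_mx 0 i) *m gram g r)
            (tan_of_coord X phi r (delta_mx 0 j)).
  apply/funext => y /=; rewrite !tan_of_coordE /pairing /coord_gram.
  by rewrite -!rowE -row_mul tr_row !mxE; apply: eq_bigr => l _; rewrite !mxE.
by apply: (gram_smooth g Aphi i j 1%N).1; exists q.
Qed.

End Charts.

(** * The projection onto the subbundle *)

Section Gamma.
Context {R : realType} {n : nat} {Q : topologicalType} (X : manifold R n Q).
Variables (g : riemannian_metric X) (M : set (cotangent_bundle R n Q)).
Local Notation E := ('rV[R]_n * 'rV[R]_n * R^o)%type.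

Lemma gram_unitmx q : gram g q \in unitmx.
Proof. exact: posdef_unitmx (@gram_pos _ _ _ _ g q). Qed.

Section LocalFrame.
Variables (U : set Q) (k : nat) (theta : Q -> 'M[R]_(k, n)).
Hypothesis theta_frame : local_frame X M U theta.
Local Notation E' := ('rV[R]_n * 'rV[R]_k * R^o)%type.

Lemma frame_gram_unitmx q : U q ->
  theta q *m invmx (gram g q) *m (theta q)^T \in unitmx.
Proof.
move=> Uq; apply: gram_rows_unitmx; first exact: (@gram_pos _ _ _ _ g q).
  exact: gram_sym.
exact: (frame_free theta_frame).
Qed.

(** The distribution is spanned by the vectors dual to the rows of [theta q]. *)
Lemma annihilator_dist_D q (b : 'rV[R]_n) : U q ->
  annihilator (dist_D M g) (q, b) <-> b *m proj_coef (gram g q) (theta q) = 0.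
Proof.
move=> Uq; rewrite mulmx_proj_coef_eq0; last exact: frame_gram_unitmx.
have pair_sharp m :
    pairing b (m *m invmx (gram g q)) = (b *m invmx (gram g q) *m m^T) 0 0.
  by rewrite /pairing trmx_mul trmx_inv gram_sym mulmxA.
split=> [b0|b0 v [[r m] Mm [/= rq <-]]].
  apply/rowP => i; rewrite [RHS]mxE.
  suff : col i (b *m invmx (gram g q) *m (theta q)^T) 0 0 = 0 by rewrite mxE.
  have := b0 (row i (theta q) *m invmx (gram g q)).
  rewrite pair_sharp tr_row colE mulmxA -colE; apply.
  exists (q, row i (theta q)) => //.
  by apply/(frame_span theta_frame Uq); exact: row_sub.
move: Mm; rewrite rq => /(frame_span theta_frame Uq)/submxP[c ->].
by rewrite pair_sharp trmx_mul mulmxA b0 mul0mx mxE.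
Qed.

(** The component in the subbundle is unique because [theta q] has the right inverse
    [proj_coef (gram g q) (theta q)], which kills the annihilator. *)
Lemma gammaE q a z : U q ->
  gamma M g (q, a, z) = (q, a *m proj_coef (gram g q) (theta q) *m theta q, z).
Proof.
move=> Uq; rewrite /gamma /=; congr (_, _, _).
have uT := frame_gram_unitmx Uq.
apply: xget_subset1 => [|m1 m2] /=.
  split; first by apply/(frame_span theta_frame Uq); exact: submxMl.
  apply/annihilator_dist_D => //.
  by rewrite mulmxBl -(mulmxA _ (theta q)) mulmx_proj_coef // mulmx1 subrr.
suff mE m : M (q, m) /\ annihilator (dist_D M g) (q, a - m) ->
    m = a *m proj_coef (gram g q) (theta q) *m theta q by move=> /mE -> /mE ->.
case=> /(frame_span theta_frame Uq)/submxP[c ->] /annihilator_dist_D.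
move=> /(_ Uq)/eqP; rewrite mulmxBl subr_eq0 => /eqP ->.
by rewrite -(mulmxA c) mulmx_proj_coef // mulmx1.
Qed.

Lemma gamma_bundle_point phi (y : E') : U (point phi y.1.1) ->
  gamma M g (bundle_point phi theta y) = bundle_point phi theta y.
Proof.
move=> Uq; rewrite /bundle_point gammaE //.
rewrite -(mulmxA y.1.2) mulmx_proj_coef ?mulmx1 //.
exact: frame_gram_unitmx.
Qed.

(** Reads the projection onto the subbundle in a trivialization of the subbundle.
    Written with [coord_gram] and [coord_frame], it is visibly differentiable. *)
Definition fibre_coord phi (y : E) : E' :=
  (y.1.1,
   y.1.2 *m proj_coef (coord_gram g phi y.1.1) (coord_frame X phi theta y.1.1),
   y.2).

(** The change of basis hidden in [can_point] cancels the one of the projection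
    coefficients, by [proj_coef_change]. *)
Lemma gamma_can_point phi (y : E) : atlas X phi ->
  dom phi (point phi y.1.1) -> U (point phi y.1.1) ->
  gamma M g (can_point X phi y) = bundle_point phi theta (fibre_coord phi y).
Proof.
move=> Aphi dq Uq; rewrite /can_point gammaE // /bundle_point /=.
rewrite /coord_gram /coord_frame proj_coef_change ?gram_unitmx ?frame_mx_unit //.
by rewrite cot_of_coordE // !mulmxA.
Qed.

Lemma can_coord_bundle_point phi (y : E') : (coord phi @` dom phi) y.1.1 ->
  can_coord X phi (bundle_point phi theta y) =
  (y.1.1, y.1.2 *m coord_frame X phi theta y.1.1, y.2).
Proof.
by move=> cy; rewrite /can_coord /bundle_point /= pointK // cot_coordE mulmxA.
Qed.

Variables (phi : chart R n Q) (Aphi : atlas X phi).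
Variables (q : Q) (dq : dom phi q) (Uq : U q).

Lemma near_base {F G : normedModType R} (y : 'rV[R]_n * F * G) :
  y.1.1 = coord phi q ->
  \forall z \near y, [/\ (coord phi @` dom phi) z.1.1, dom phi (point phi z.1.1)
                       & U (point phi z.1.1)].
Proof.
move=> yq; have := near_chart (frame_open theta_frame) dq Uq; rewrite -yq.
have : {for y, continuous (fun z : 'rV[R]_n * F * G => z.1.1)}.
  by apply: continuous_comp; exact: cvg_fst.
exact.
Qed.

Lemma differentiable_fibre_coord (y : E) : y.1.1 = coord phi q ->
  differentiable (fibre_coord phi) y.
Proof.
move=> yq; apply: (@differentiable_bundle_map _ _ _ _ (fun z =>
  proj_coef (coord_gram g phi z) (coord_frame X phi theta z))).
rewrite yq; have dT := differentiable_coord_frame Aphi theta_frame dq Uq.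
have dG := differentiable_coord_gram g Aphi dq.
have nearU := near_chart (frame_open theta_frame) dq Uq.
have dGi : differentiable (fun z => invmx (coord_gram g phi z)) (coord phi q).
  apply: differentiable_invmx => //; apply: filterS nearU => z [_ dz _].
  by rewrite !unitmx_mul unitmx_tr frame_mx_unit ?gram_unitmx.
have dTt := differentiable_trmx dT.
apply: differentiable_mulmx; first exact: differentiable_mulmx.
apply: differentiable_invmx.
  by apply: differentiable_mulmx => //; exact: differentiable_mulmx.
apply: filterS nearU => z [_ dz Uz]; rewrite /coord_frame /coord_gram.
by rewrite gram_rows_change ?gram_unitmx ?frame_mx_unit ?frame_gram_unitmx.
Qed.

Lemma differentiable_can_coord_bundle_point (y : E') : y.1.1 = coord phi q ->
  differentiable (can_coord X phi \o bundle_point phi theta) y.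
Proof.
move=> yq; have dB : differentiable (fun z : E' =>
    (z.1.1, z.1.2 *m coord_frame X phi theta z.1.1, z.2) : E) y.
  apply: differentiable_bundle_map; rewrite yq.
  exact: differentiable_coord_frame theta_frame dq Uq.
apply: differentiable_near dB; have := near_base yq.
by apply: filterS => z [cz _ _]; rewrite /= can_coord_bundle_point.
Qed.

Lemma differentiable_bundle_point (f : cotangent_bundle R n Q * R -> R) (y : E') :
  smooth_on_MxR X M f -> y.1.1 = coord phi q ->
  differentiable (f \o bundle_point phi theta : _ -> R^o) y.
Proof.
move=> smoothf yq; apply: (smoothf _ _ _ _ Aphi theta_frame 1%N).1.
by rewrite /= yq; exists q.
Qed.

End LocalFrame.
End Gamma.

(** * The differential of the projection and the brackets *)

Section Projection.
Context {R : realType} {n : nat} {Q : topologicalType} (X : manifold R n Q).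
Variables (g : riemannian_metric X) (M : set (cotangent_bundle R n Q)).
Variables (phi : chart R n Q) (Aphi : atlas X phi).
Local Notation E := ('rV[R]_n * 'rV[R]_n * R^o)%type.
Local Notation TQR := (cotangent_bundle R n Q * R)%type.
Local Notation lift f := (f \o gamma M g \o can_point X phi).
Local Notation gamma_coord := (lift (can_coord X phi)).

Variables (x : TQR) (dx : dom phi x.1.1).
Local Notation y0 := (can_coord X phi x).

Section Frame.
Variables (U : set Q) (k : nat) (theta : Q -> 'M[R]_(k, n)).
Hypotheses (theta_frame : local_frame X M U theta) (Ux : U x.1.1).
Local Notation E' := ('rV[R]_n * 'rV[R]_k * R^o)%type.

(** The projection [gamma] is the identity on the image of [bundle_point], so the
    lift composed with the parametrization is [f] in that parametrization. This
    holds in every local frame, whence the independence of [diff_MxR] from the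
    frame. *)
Lemma diff_lift_bundle {F : normedModType R} (f : TQR -> F) (y w : E') :
  y.1.1 = coord phi x.1.1 -> bundle_point phi theta y = x ->
  differentiable (lift f : E -> F) y0 ->
  'd (lift f : E -> F) y0 ('d (can_coord X phi \o bundle_point phi theta) y w) =
  'd (f \o bundle_point phi theta : _ -> F) y w.
Proof.
move=> yx Byx; rewrite -Byx => df.
have dB := differentiable_can_coord_bundle_point theta_frame Aphi dx Ux yx.
apply: (diff_comp_near w dB df).
have := near_base theta_frame dx Ux yx; apply: filterS => z [cz dz Uz].
by rewrite /= can_coordK // (gamma_bundle_point g theta_frame).
Qed.

Lemma bundle_point_fibre_coord : MxR M x ->
  bundle_point phi theta (fibre_coord g theta phi y0) = x.
Proof.
move=> Mx; rewrite -(gamma_can_point g theta_frame Aphi) /= ?coordK // can_coordK //.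
case: x Mx Ux => [[q a] z] /= Mx Uq; rewrite (gammaE g theta_frame) //.
have [c ->] := submxP ((frame_span theta_frame Uq a).1 Mx).
rewrite -(mulmxA c) mulmx_proj_coef ?mulmx1 //.
exact: (frame_gram_unitmx g theta_frame).
Qed.

Lemma near_lift {F : normedModType R} (f : TQR -> F) :
  {near y0, (f \o bundle_point phi theta) \o fibre_coord g theta phi =1 lift f}.
Proof.
have := near_base theta_frame dx Ux (erefl y0.1.1).
apply: filterS => z [cz dz Uz] /=.
by rewrite (gamma_can_point g theta_frame Aphi).
Qed.

Lemma differentiable_lift {F : normedModType R} (f : TQR -> F) :
  (forall y : E', y.1.1 = coord phi x.1.1 ->
    differentiable (f \o bundle_point phi theta) y) ->
  differentiable (lift f : E -> F) y0.
Proof.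
move=> df; apply: differentiable_near (near_lift f) _.
apply: differentiable_comp; last exact: df.
exact: (differentiable_fibre_coord g theta_frame Aphi dx Ux).
Qed.

(** Conversely the lift is [f] in one parametrization composed with the coordinates
    of the projection. *)
Lemma diff_lift_fibre_coord {F : normedModType R} (f : TQR -> F) v :
  differentiable (f \o bundle_point phi theta) (fibre_coord g theta phi y0) ->
  'd (lift f : E -> F) y0 v =
  'd (f \o bundle_point phi theta) (fibre_coord g theta phi y0)
     ('d (fibre_coord g theta phi) y0 v).
Proof.
move=> df; apply/esym/(diff_comp_near v _ df (near_lift f)).
exact: (differentiable_fibre_coord g theta_frame Aphi dx Ux).
Qed.

Lemma differentiable_gamma_coord : differentiable (gamma_coord : E -> E) y0.
Proof.
apply: differentiable_lift => y yx.
exact: (differentiable_can_coord_bundle_point theta_frame Aphi dx Ux yx).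
Qed.

Definition coord_proj (y : 'rV[R]_n) : 'M[R]_n :=
  proj_coef (coord_gram g phi y) (coord_frame X phi theta y) *m
  coord_frame X phi theta y.

Lemma near_gamma_coord : {near y0, gamma_coord =1
   fun y => (y.1.1, y.1.2 *m coord_proj y.1.1, y.2)}.
Proof.
have := near_base theta_frame dx Ux (erefl y0.1.1).
apply: filterS => z [cz dz Uz] /=.
rewrite (gamma_can_point g theta_frame Aphi) // can_coord_bundle_point //=.
by rewrite -mulmxA.
Qed.

Lemma diff_gamma_coord_base v : let w := 'd (gamma_coord : E -> E) y0 v in
  w.1.1 = v.1.1 /\ w.2 = v.2.
Proof.
have dG := differentiable_gamma_coord; split.
  rewrite -[RHS](diff_base y0) -(diff_base ((gamma_coord : E -> E) y0)).
  apply: (diff_comp_near v dG (differentiable_base _)).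
  by apply: filterS near_gamma_coord => z /(congr1 (fun w : E => w.1.1)).
rewrite -(diff_snd ((gamma_coord : E -> E) y0)) -[RHS](diff_snd y0 v).
apply: (diff_comp_near v dG (differentiable_snd _)).
by apply: filterS near_gamma_coord => z /(congr1 (fun w : E => w.2)).
Qed.

(** On the fibre of the cotangent bundle through the point, [gamma] is linear. *)
Lemma diff_gamma_coord_vertical (b : 'rV[R]_n) :
  'd (gamma_coord : E -> E) y0 (0, b, 0) = (0, b *m coord_proj y0.1.1, 0).
Proof.
rewrite -deriveE; last exact: differentiable_gamma_coord.
rewrite (near_eq_derive _ near_gamma_coord).
apply: derive_affine; apply: filterE => h /=.
rewrite !scaler0 !add0r mulmxDl -scalemxAl.
rewrite [RHS](_ : _ = (y0.1.1 + h *: 0, y0.1.2 *m coord_proj y0.1.1 +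
  h *: (b *m coord_proj y0.1.1), y0.2 + h *: 0)) //.
by rewrite !scaler0 !addr0 [in LHS]addrC.
Qed.

Lemma sharp_Q_pullback (y : E) q (b : 'rV[R]_n) :
  sharp_Q y (fun w => pairing b (tan_of_coord X phi q w.1.1)) =
  (0, - (b *m (frame_mx X phi q)^T), 0).
Proof.
rewrite -(sharp_Q_horizontal y); congr sharp_Q; apply/funext => w.
by rewrite tan_of_coordE /pairing trmx_mul mulmxA.
Qed.

(** The differential of [gamma] keeps the components along Q x R and acts on
    vertical vectors as the projection itself; so its kernel consists of the
    vectors (0, b, 0) with b in the annihilator of the distribution, and these are
    the sharps of the pulled back annihilator. *)
Lemma Dl_perp_kernel v :
  Dl_perp M g phi x v <-> 'd (gamma_coord : E -> E) y0 v = 0.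
Proof.
set J := frame_mx X phi x.1.1; have uJ : J \in unitmx by exact: frame_mx_unit.
have uJT : J^T \in unitmx by rewrite unitmx_tr.
set C := proj_coef (gram g x.1.1) (theta x.1.1).
have projP (p : 'rV[R]_n) : p *m coord_proj y0.1.1 = 0 <-> p *m invmx J^T *m C = 0.
  rewrite /coord_proj /coord_gram /coord_frame /= coordK //.
  rewrite proj_coef_change ?gram_unitmx // trmx_inv.
  apply: mulmx_conj_proj_eq0 => //; apply: mulmx_proj_coef.
  exact (frame_gram_unitmx g theta_frame Ux).
have annE b : annihilator (dist_D M g) (x.1.1, b) <-> b *m C = 0.
  exact (annihilator_dist_D g theta_frame b Ux).
split=> [[_ [b /annE b0 ->] <-]|v0].
  have bP : b *m J^T *m coord_proj y0.1.1 = 0 by apply/projP; rewrite mulmxK.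
  by rewrite sharp_Q_pullback diff_gamma_coord_vertical mulNmx bP oppr0.
have [] := diff_gamma_coord_base v; rewrite v0 /= => vq vz.
have vE : v = (0, v.1.2, 0) by case: v vq vz {v0} => [[? ?] ?] /= <- <-.
have /projP va : v.1.2 *m coord_proj y0.1.1 = 0.
  have /(congr1 (fun w : E => w.1.2)) := diff_gamma_coord_vertical v.1.2.
  by rewrite -vE v0 /= => <-.
exists (fun w =>
  pairing (- (v.1.2 *m invmx J^T)) (tan_of_coord X phi x.1.1 w.1.1)).
  by eexists; last reflexivity; apply/annE; rewrite mulNmx va oppr0.
by rewrite sharp_Q_pullback mulNmx opprK mulmxKV // -vE.
Qed.

End Frame.

Hypotheses (subM : vector_subbundle X M) (Mx : MxR M x).

Lemma diff_gamma_coord_tangent v :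
  tangent_MxR X M phi x ('d (gamma_coord : E -> E) y0 v).
Proof.
have [U [k [theta [Ux tf]]]] := subM x.1.1.
exists U, k, theta, (fibre_coord g theta phi y0),
  ('d (fibre_coord g theta phi) y0 v).
split => //; first by split=> //; exact: bundle_point_fibre_coord tf Ux Mx.
apply: (diff_lift_fibre_coord tf Ux).
exact: (@differentiable_can_coord_bundle_point
  _ _ _ _ _ _ _ _ tf _ Aphi _ dx Ux).
Qed.

(** As [gamma] is a retraction onto M x R, its differential is a projection onto the
    tangent space of M x R. *)
Lemma tangent_MxR_fixed v :
  tangent_MxR X M phi x v <-> 'd (gamma_coord : E -> E) y0 v = v.
Proof.
split=> [[U [k [theta [y [w [tf Ux [yx Byx] ->]]]]]]|<-].
  apply: (diff_lift_bundle tf Ux) => //; exact: (differentiable_gamma_coord tf Ux).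
exact: diff_gamma_coord_tangent.
Qed.

(** The range and the kernel of the idempotent 'd [gamma] are the two summands that
    define [proj_P]. *)
Lemma proj_PE v : proj_P M g phi x v = 'd (gamma_coord : E -> E) y0 v.
Proof.
have [U [k [theta [Ux tf]]]] := subM x.1.1.
set L := 'd _ y0; have Lt := diff_gamma_coord_tangent v.
apply: xget_subset1.
  split=> //; apply/(Dl_perp_kernel tf Ux); rewrite linearB /=.
  by apply/eqP; rewrite subr_eq0 eq_sym; apply/eqP/tangent_MxR_fixed.
suff wE w : tangent_MxR X M phi x w /\ Dl_perp M g phi x (v - w) -> w = L v.
  by move=> a b /wE -> /wE ->.
case=> /tangent_MxR_fixed w_fix /(Dl_perp_kernel tf Ux)/eqP.
by rewrite linearB subr_eq0 => /eqP; rewrite w_fix.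
Qed.

Variables (f : TQR -> R) (smoothf : smooth_on_MxR X M f).

Lemma differentiable_lift_smooth : differentiable (lift f : E -> R^o) y0.
Proof.
have [U [k [theta [Ux tf]]]] := subM x.1.1.
apply: (differentiable_lift tf Ux) => y yx.
exact: (@differentiable_bundle_point
  _ _ _ _ _ _ _ _ tf _ Aphi _ dx Ux _ _ smoothf yx).
Qed.

Lemma diff_MxR_tangent v : tangent_MxR X M phi x v ->
  diff_MxR X M phi f x v = diff_TQR X phi (f \o gamma M g) x v.
Proof.
have df := differentiable_lift_smooth.
move=> [U [k [theta [y [w [tf Ux [yx Byx] ->]]]]]].
set t := 'd _ y w.
suff cE c : diff_MxR_rel X M phi f x t c -> c = diff_TQR X phi (f \o gamma M g) x t.
  apply: xget_subset1 => [|c1 c2 /cE -> /cE -> //].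
  exists U, k, theta, y, w; split => //.
  exact: (diff_lift_bundle tf Ux w yx Byx df).
case=> U' [k' [theta' [y' [w' [tf' Ux' [yx' Byx'] -> ->]]]]].
exact/esym/(diff_lift_bundle tf' Ux' w' yx' Byx' df).
Qed.

(** Since f o [gamma] o [gamma] = f o [gamma], the differential of f o [gamma] is
    unchanged by composing it with 'd [gamma] = [proj_P]. *)
Lemma diff_MxR_proj_P v :
  diff_MxR X M phi f x (proj_P M g phi x v) = diff_TQR X phi (f \o gamma M g) x v.
Proof.
rewrite proj_PE diff_MxR_tangent; last exact: diff_gamma_coord_tangent.
have [U [k [theta [Ux tf]]]] := subM x.1.1.
have Sx := bundle_point_fibre_coord tf Ux Mx.
have Sq : (fibre_coord g theta phi y0).1.1 = coord phi x.1.1 by [].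
rewrite (diff_lift_fibre_coord tf Ux (f := can_coord X phi) v); last first.
  exact: (@differentiable_can_coord_bundle_point
  _ _ _ _ _ _ _ _ tf _ Aphi _ dx Ux).
rewrite /diff_TQR.
rewrite [LHS](diff_lift_bundle tf Ux _ Sq Sx differentiable_lift_smooth).
apply/esym/(diff_lift_fibre_coord tf Ux).
exact: (@differentiable_bundle_point
  _ _ _ _ _ _ _ _ tf _ Aphi _ dx Ux _ _ smoothf).
Qed.

Lemma gamma_id : gamma M g x = x.
Proof.
have [U [k [theta [Ux tf]]]] := subM x.1.1.
rewrite -{1}(can_coordK Aphi dx) (gamma_can_point g tf Aphi) /= ?coordK //.
exact: (bundle_point_fibre_coord tf Ux Mx).
Qed.

End Projection.

Theorem theorem19 (R : realType) (n : nat) (Q : topologicalType)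
    (X : manifold R n Q) (g : riemannian_metric X)
    (V : Q * R -> R) (smoothV : smooth_on_QxR X V)
    (H : cotangent_bundle R n Q * R -> R) (mechH : mechanical g V H)
    (M : set (cotangent_bundle R n Q)) (subM : vector_subbundle X M)
    (f h : cotangent_bundle R n Q * R -> R)
    (smoothf : smooth_on_MxR X M f) (smoothh : smooth_on_MxR X M h)
    (phi : chart R n Q) (atlas_phi : atlas X phi)
    (x : cotangent_bundle R n Q * R) (Mx : MxR M x) (dom_x : dom phi x.1.1) :
  nonholonomic_bracket M g phi f h x = eden_bracket M g phi f h x /\
  eden_bracket M g phi f h x =
    jacobi_bracket X phi (f \o gamma M g) (h \o gamma M g) x.
Proof.
split=> //.
have diffE u v : smooth_on_MxR X M u ->
    diff_MxR X M phi u x (proj_P M g phi x v) = diff_TQR X phi (u \o gamma M g) x v.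
  by move=> smu; exact: diff_MxR_proj_P.
have gx u : (u \o gamma M g) x = u x :> R.
  by rewrite /= (gamma_id _ atlas_phi dom_x subM Mx).
have LE : Lambda_HM M g phi x (diff_MxR X M phi f x) (diff_MxR X M phi h x) =
    Lambda_Q (can_coord X phi x) (diff_TQR X phi (f \o gamma M g) x)
      (diff_TQR X phi (h \o gamma M g) x).
  have fE := funext (fun v => diffE f v smoothf).
  have hE := funext (fun v => diffE h v smoothh).
  exact: (congr2 (Lambda_Q (can_coord X phi x)) fE hE).
by rewrite /eden_bracket /jacobi_bracket !gx /nonholonomic_bracket LE /reeb_HM !diffE.
Qed.
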